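(* Let $n$ and $k$ be integers with $2\le k\le\lfloor n/2\rfloor-1$, and let $D=C_n([k])$. (a) If $n\not\equiv 0,1 \pmod k$, then $\overrightarrow{rvc}(D)=\lceil n/k\rceil-1$; moreover $\overrightarrow{srvc}(D)=\lceil n/k\rceil$ for all sufficiently large $n$. (b) Let $n=ak+1$ with $a\ge 3$. (i) If $(a-1)\mid n$, then $\overrightarrow{rvc}(D)=\overrightarrow{srvc}(D)=\frac{n-1}{k}-1$. (ii) If $(a-1)\nmid n$, then $\overrightarrow{rvc}(D)=\frac{n-1}{k}$; furthermore $\overrightarrow{srvc}(D)=\frac{n-1}{k}$ if $a<k+2$, and $\overrightarrow{srvc}(D)=\frac{n-1}{k}+1=\lceil n/k\rceil$ if $a>k+2$. (c) Let $n=ak$ with $a\ge 3$. (i) If $a\in\{3,4\}$, then $\overrightarrow{rvc}(D)=\overrightarrow{srvc}(D)=\frac{n}{k}-1$. (ii) If $a\ge 5$, then $\overrightarrow{rvc}(D)\in\{\frac{n}{k}-1,\frac{n}{k}\}$ and $\overrightarrow{srvc}(D)=\frac{n}{k}$.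
   Context: All digraphs are finite and simple. A (directed) path is a sequence of distinct vertices $x_0,\dots,x_\ell$ with each $x_{i-1}x_i$ an arc; its length is $\ell$. A digraph is strongly connected if for every ordered pair $(u,v)$ there is a $u$–$v$ path; a $u$–$v$ geodesic is a shortest $u$–$v$ path. In a vertex-coloured digraph, a path is rainbow if its internal vertices have pairwise distinct colours. A vertex-colouring of a strongly connected digraph $D$ is rainbow vertex-connected if every ordered pair $(u,v)$ is joined by a rainbow $u$–$v$ path, and strongly rainbow vertex-connected if every ordered pair is joined by a rainbow $u$–$v$ geodesic. $\overrightarrow{rvc}(D)$ (resp. $\overrightarrow{srvc}(D)$) is the minimum number of colours in a rainbow vertex-connected (resp. strongly rainbow vertex-connected) vertex-colouring of $D$. For $n\ge 3$ and $S\subseteq\{1,\dots,n-1\}$, the circulant digraph $C_n(S)$ has vertex set $\{v_0,\dots,v_{n-1}\}$ and arc set $\{v_iv_j : j-i\equiv s \pmod n \text{ for some } s\in S\}$. For an integer $k\ge1$, $[k]=\{1,2,\dots,k\}$. *)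

(* Defs.v *)
From mathcomp Require Import all_boot.

Set Implicit Arguments.
Unset Strict Implicit.
Unset Printing Implicit Defensive.

(* MathComp.  A finite digraph is an arc relation [e : rel T] on a
   [T : finType]; it is simple when [e] is irreflexive. *)

Section Digraph.

Variables (T : finType) (e : rel T).

(* A path x_0, ..., x_l is given by its start x_0 = u and the sequence
   p = [:: x_1; ...; x_l]; its length is [size p]. *)
Definition dipath (u v : T) (p : seq T) : bool :=
  [&& path e u p, last u p == v & uniq (u :: p)].

Definition geodesic (u v : T) (p : seq T) : Prop :=
  dipath u v p /\ forall q, dipath u v q -> size p <= size q.

(* x_1, ..., x_{l-1}; empty when l <= 1. *)
Definition internal (u : T) (p : seq T) : seq T := behead (belast u p).

Definition rainbow (C : eqType) (c : T -> C) (u : T) (p : seq T) : bool :=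
  uniq [seq c x | x <- internal u p].

(* Strong connectedness of the digraph is implied by either property. *)
Definition rainbow_vertex_connected (C : eqType) (c : T -> C) : Prop :=
  forall u v : T, exists p, dipath u v p /\ rainbow c u p.

Definition strongly_rainbow_vertex_connected (C : eqType) (c : T -> C) : Prop :=
  forall u v : T, exists p, geodesic u v p /\ rainbow c u p.

(* [is_rvc m] reads "rvc(D) = m".  A colouring is a map to m available colours,
   not required to be surjective; this does not affect the minimum. *)
Definition is_rvc (m : nat) : Prop :=
  (exists c : T -> 'I_m, rainbow_vertex_connected c) /\
  (forall m' (c : T -> 'I_m'), rainbow_vertex_connected c -> m <= m').

Definition is_srvc (m : nat) : Prop :=
  (exists c : T -> 'I_m, strongly_rainbow_vertex_connected c) /\
  (forall m' (c : T -> 'I_m'), strongly_rainbow_vertex_connected c -> m <= m').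

End Digraph.

(* The circulant digraph C_n(S) on 'I_n, meaningful for S included in
   {1, ..., n-1}, with v_i represented by i. *)
Definition circulant (n : nat) (S : seq nat) : rel 'I_n :=
  fun i j => has (fun s => j == i + s %[mod n]) S.
Arguments circulant : clear implicits.

Lemma circulant_irrefl (n : nat) (S : seq nat) :
  all (fun s => 0 < s < n) S -> irreflexive (circulant n S).
Proof.
move=> /allP S_bnd i; apply/negP => /hasP [s /S_bnd /andP [s_gt0 s_ltn]].
rewrite -{1}[nat_of_ord i]addn0 eqn_modDl mod0n modn_small // => /eqP s0.
by rewrite -s0 in s_gt0.
Qed.

Definition ceil_div (n k : nat) : nat := (n + k.-1) %/ k.

Lemma ceil_div_leq (n k q : nat) : 0 < k -> (ceil_div n k <= q) = (n <= q * k).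
Proof.
case: k => // k _; rewrite /ceil_div /= -ltnS ltn_divLR // mulSn.
by rewrite [k.+1 + _]addnC addnS ltnS leq_add2r.
Qed.

(* Main.v *)
Require Import Defs.
From Stdlib Require Import Classical.
From mathcomp Require Import all_boot zify.

(* A u-v path lifts to a walk from 0 to an integer x congruent to v - u by steps
   in {1, ..., k}, so d(u, u + x) = ceil(x / k) for 0 < x < n, and a path of
   length l from u to u + l k must use the vertices u + i k.  Hence, if
   l k < n, a strong colouring gives distinct colours to any l - 1 consecutive
   vertices of an orbit of the rotation by k.  Double counting then bounds each
   colour class by n / (l - 1), which gives the lower bounds not coming from the
   diameter, except when k divides n: then the orbits have only n / k vertices,
   and those of one orbit must all get distinct colours if n / k >= 5.
   The strong colourings with ceil(n / k) colours are constant on blocks of k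
   consecutive vertices.  For the rainbow colourings with floor(n / k) colours
   when k does not divide n, let g = gcd(n, k), and colour every orbit
   periodically from some origin: the only bad windows are those across the
   origin, and when the window u + k, u + 2k, ... is bad, the window u - g + k,
   u - g + 2k, ... of the same orbit is good and reaches the same targets. *)

Set Implicit Arguments.
Unset Strict Implicit.
Unset Printing Implicit Defensive.

(** * Paths of the circulant as integer walks *)

Lemma shift_subproof n (u : 'I_n) x : (u + x) %% n < n.
Proof. by rewrite ltn_pmod // (leq_ltn_trans _ (ltn_ord u)). Qed.

Definition shift n (u : 'I_n) x : 'I_n := Ordinal (shift_subproof u x).

Lemma shiftD n (u : 'I_n) x y : shift (shift u x) y = shift u (x + y).
Proof. by apply: val_inj; rewrite /= modnDml addnA. Qed.

Lemma shift0 n (u : 'I_n) : shift u 0 = u.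
Proof. by apply: val_inj; rewrite /= addn0 modn_small. Qed.

Lemma shift_eq n (u : 'I_n) x y : (shift u x == shift u y) = (x == y %[mod n]).
Proof. by rewrite -val_eqE /= eqn_modDl. Qed.

Lemma shift_mod n (u : 'I_n) x y : x = y %[mod n] -> shift u x = shift u y.
Proof. by move=> /eqP xy; apply/eqP; rewrite shift_eq. Qed.

Lemma shiftP n (u v : 'I_n) : {x | x < n & v = shift u x}.
Proof.
have n0 : 0 < n by apply: leq_ltn_trans (ltn_ord u).
exists ((v + (n - u)) %% n); first exact: ltn_pmod.
apply: val_inj; rewrite /= modnDmr addnCA subnKC ?modnDr ?modn_small //.
exact: ltnW.
Qed.

Lemma shift_inj n x : injective (fun u : 'I_n => shift u x).
Proof.
move=> u v /eqP; have [y _ ->] := shiftP u v.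
rewrite shiftD shift_eq -{1}[x]add0n eqn_modDr -(shift_eq u) shift0.
by move/eqP.
Qed.

Lemma circulantE n k (u v : 'I_n) :
  reflect (exists2 s, 0 < s <= k & v = shift u s) (circulant n (iota 1 k) u v).
Proof.
apply: (iffP hasP) => -[s s_k /eqP uv]; exists s; rewrite ?mem_iota //.
- by move: s_k; rewrite mem_iota; lia.
- by apply: val_inj; rewrite /= -uv modn_small.
- by rewrite (eqP uv) /= modn_mod.
Qed.

Definition step k : rel nat := fun x y => x < y <= x + k.

Lemma lift_path n k (u : 'I_n) x p :
  path (circulant n (iota 1 k)) (shift u x) p ->
  exists2 s, p = [seq shift u y | y <- s] & path (step k) x s.
Proof.
elim: p x => [|v p IHp] x /=; first by exists [::].
case/andP=> /circulantE[y y_k ->]; rewrite shiftD => /IHp[s -> xs].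
by exists (x + y :: s) => //=; rewrite /step xs; lia.
Qed.

Lemma last_step k x s : path (step k) x s ->
  x <= last x s <= x + size s * k.
Proof.
elim: s x => [|y s IHs] x /=; first by lia.
by rewrite /step => /andP[xy /IHs]; lia.
Qed.

(** Steps are at most [k], so attaining the bound of [last_step] forces each of them to be exactly
    [k]. *)
Lemma last_step_eq k x s : path (step k) x s -> last x s = x + size s * k ->
  s = [seq x + i * k | i <- iota 1 (size s)].
Proof.
elim: s x => [//|y s IHs] x /= /andP[xy ys] e.
have := last_step ys; rewrite /step in xy => yl.
have {}xy : y = x + k by lia.
rewrite mul1n -xy; congr cons; rewrite {1}(IHs y) //; last lia.
by rewrite (iotaDl 1 1) -map_comp; apply: eq_map => i /=; lia.
Qed.

(** An increasing sequence of integers below [n] stays free of repetitions modulo [n]. *)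
Lemma dipath_shift n k (u : 'I_n) s x :
    path (step k) 0 (rcons s x) -> x < n ->
  let p := [seq shift u y | y <- rcons s x] in
  dipath (circulant n (iota 1 k)) u (shift u x) p /\
  internal u p = [seq shift u y | y <- s].
Proof.
move=> sx xn p; split; last first.
  rewrite /internal /p map_rcons belast_rcons.
  by case: (s).
apply/and3P; split.
- have: path (circulant n (iota 1 k)) (shift u 0) p.
    rewrite (homo_path (e := step k)) // => y z yz.
    apply/circulantE; exists (z - y); rewrite /step in yz; first lia.
    by rewrite shiftD subnKC //; lia.
  by rewrite shift0.
- by rewrite /p map_rcons last_rcons.
- rewrite -{1}(shift0 u) -[_ :: _]/(map (shift u) (0 :: rcons s x)).
  have srt : sorted ltn (0 :: rcons s x).
    by apply: sub_path sx => y z /andP[].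
  rewrite map_inj_in_uniq; first exact: sorted_uniq ltn_trans ltnn _ srt.
  have lt_n y : y \in 0 :: rcons s x -> y < n.
    have := srt; rewrite -rcons_cons.
    rewrite (sorted_pairwise ltn_trans) pairwise_rcons => /andP[/allP yx _].
    by rewrite mem_rcons inE => /predU1P[-> //|/yx yx']; apply: ltn_trans xn.
  move=> y z /lt_n yn /lt_n zn /eqP; rewrite shift_eq !modn_small //.
  by move/eqP.
Qed.

Lemma dipath_lift n k (u : 'I_n) x p :
    dipath (circulant n (iota 1 k)) u (shift u x) p -> x < n ->
  x <= size p * k.
Proof.
case/and3P=> up /eqP lp _ xn.
have [|s ps s_path] := @lift_path n k u 0 p; first by rewrite shift0.
have /andP[_] := last_step s_path; rewrite add0n ps size_map.
apply: leq_trans; have := last_map (shift u) s 0.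
rewrite shift0 -ps lp => /eqP; rewrite shift_eq (modn_small xn) => /eqP ->.
exact: leq_mod.
Qed.

(** The lift ends at an integer congruent to [l * k] and at most [l * k < n], hence at [l * k]
    itself, the farthest point within reach of [l] steps. *)
Lemma dipath_forced n k (u : 'I_n) l p :
    dipath (circulant n (iota 1 k)) u (shift u (l * k)) p ->
    l * k < n -> size p <= l -> 0 < k ->
  internal u p = [seq shift u (i * k) | i <- iota 1 l.-1].
Proof.
move=> dp lkn pl k0; have := dipath_lift dp lkn; rewrite leq_pmul2r // => lp.
have {lp pl} sz : size p = l by apply/eqP; rewrite eqn_leq pl.
case/and3P: dp => up /eqP lp _.
have [|s ps s_path] := @lift_path n k u 0 p; first by rewrite shift0.
have szs : size s = l by rewrite -sz ps size_map.
have ls := last_step s_path; rewrite szs in ls.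
have {}lp : last 0 s = 0 + size s * k.
  have := last_map (shift u) s 0; rewrite shift0 -ps lp => /eqP.
  by rewrite shift_eq szs !modn_small ?add0n => [/eqP|//|]; lia.
rewrite ps (last_step_eq s_path lp) szs; case: (l) => [//|j].
have -> : iota 1 j.+1 = rcons (iota 1 j) j.+1.
  by rewrite -[in LHS](addn1 j) iotaD cats1.
rewrite !map_rcons /internal belast_rcons /= -map_comp.
by apply: eq_map.
Qed.

(** * Windows of consecutive vertices on an orbit *)

Lemma strongly_rainbow (T : finType) (e : rel T) (C : eqType) (c : T -> C) :
  strongly_rainbow_vertex_connected e c -> rainbow_vertex_connected e c.
Proof. by move=> srv u v; have [p [[uv _] r]] := srv u v; exists p. Qed.

Lemma rainbow_inj (T : finType) (C C' : eqType) (h : C -> C') (c : T -> C) u p :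
  injective h -> rainbow (h \o c) u p = rainbow c u p.
Proof. by move=> h_inj; rewrite /rainbow -(map_inj_uniq h_inj) -map_comp. Qed.

Lemma is_rvc_min (T : finType) (e : rel T) m :
    (exists c : T -> 'I_m, rainbow_vertex_connected e c) ->
    (forall c : T -> 'I_m.-1, ~ rainbow_vertex_connected e c) ->
  is_rvc e m.
Proof.
move=> ex no; split=> // m' c rc; rewrite leqNgt; apply/negP => lt_m'm.
have le_m' : m' <= m.-1 by lia.
have h_inj : injective (widen_ord le_m').
  by move=> x y /(congr1 val) /= /val_inj.
apply: (no (widen_ord le_m' \o c)) => u v.
have [p [uv r]] := rc u v; exists p.
by split; rewrite ?(rainbow_inj _ _ _ h_inj).
Qed.

Lemma is_srvc_min (T : finType) (e : rel T) m :
    (exists c : T -> 'I_m, strongly_rainbow_vertex_connected e c) ->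
    (forall c : T -> 'I_m.-1, ~ strongly_rainbow_vertex_connected e c) ->
  is_srvc e m.
Proof.
move=> ex no; split=> // m' c rc; rewrite leqNgt; apply/negP => lt_m'm.
have le_m' : m' <= m.-1 by lia.
have h_inj : injective (widen_ord le_m').
  by move=> x y /(congr1 val) /= /val_inj.
apply: (no (widen_ord le_m' \o c)) => u v.
have [p [uv r]] := rc u v; exists p.
by split; rewrite ?(rainbow_inj _ _ _ h_inj).
Qed.

Lemma rainbow_size (T : finType) m (c : T -> 'I_m) u p :
  rainbow c u p -> size p <= m.+1.
Proof.
move=> /card_uniqP r; have := max_card (mem [seq c x | x <- internal u p]).
by rewrite r size_map card_ord size_behead size_belast; lia.
Qed.

(** Pairwise form of the condition that any [w] consecutive vertices of an orbit of the rotation by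
    [k] have distinct colours. *)
Definition windows n (C : eqType) (c : 'I_n -> C) k w :=
  forall v j, 0 < j < w -> c v != c (shift v (j * k)).

Lemma windows_uniq n (C : eqType) (c : 'I_n -> C) k w l u :
    windows c k w -> l <= w ->
  uniq [seq c (shift u (i * k)) | i <- iota 1 l].
Proof.
move=> cw lw; rewrite map_inj_in_uniq ?iota_uniq // => i j.
rewrite !mem_iota; wlog ij : i j / i <= j => [hw il jl e|il jl /eqP e].
  by case/orP: (leq_total i j) => ij; [exact: hw|exact/esym/hw].
apply/eqP; rewrite eqn_leq ij /= leqNgt; apply/negP => {}ij.
have := cw (shift u (i * k)) (j - i).
rewrite shiftD -mulnDl; have -> : i + (j - i) = j by lia.
by rewrite e => /(_ _)/negP; apply=> //; lia.
Qed.

Lemma uniq_windows n (C : eqType) (c : 'I_n -> C) k w : k <= n ->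
    (forall u, uniq [seq c (shift u (i * k)) | i <- iota 1 w]) ->
  windows c k w.
Proof.
(* The window that follows [v - k] begins at [v] itself. *)
move=> kn cu v j jw; have := cu (shift v (n - k)).
case: w cu jw => [|w] cu jw /=; first by lia.
rewrite mul1n shiftD subnK // => /andP[+ _].
rewrite (@shift_mod _ v n 0) ?modnn ?mod0n // shift0.
apply: contraNneq => ->; apply/mapP; exists j.+1.
  by rewrite mem_iota; lia.
congr (c _); rewrite shiftD; apply: shift_mod.
by rewrite mulSn addnA subnK // modnDl.
Qed.

(** Fix a colour and sum the size of its class over [w] rotations by multiples of [k]: each vertex
    contributes at most 1, since its window shows that colour at most once. *)
Lemma windows_bound n m (c : 'I_n -> 'I_m) k w : 0 < w ->
  windows c k w -> n <= m * (n %/ w).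
Proof.
move=> w0 cw.
have class_le a : #|[pred v | c v == a]| <= n %/ w.
  rewrite leq_divRL //; set N := #|_|.
  have -> : N * w = \sum_(1 <= i < w.+1) N.
    by rewrite sum_nat_const_nat subn1 mulnC.
  have shN i : N = \sum_u (c (shift u (i * k)) == a).
    rewrite /N -sum1_card big_mkcond /=.
    rewrite (reindex_inj (@shift_inj n (i * k))) /=.
    by apply: eq_bigr => u _; rewrite inE; case: eqP.
  rewrite (eq_bigr _ (fun i _ => shN i)) exchange_big /=.
  rewrite -[X in _ <= X]card_ord -sum1_card; apply: leq_sum => u _.
  have := windows_uniq u cw (leqnn w) => /(count_uniq_mem a).
  rewrite count_map -sum1_count big_mkcond /index_iota subn1 /= => e.
  apply: leq_trans (leq_trans (eq_leq e) (leq_b1 _)).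
  by apply: leq_sum => i _ /=; case: eqP.
rewrite -[X in X <= _]card_ord -sum1_card (partition_big c predT) //=.
rewrite -[X in X * _](card_ord m) -sum_nat_const; apply: leq_sum => a _.
by rewrite sum1_card class_le.
Qed.

(** Truncated subtraction puts the point of index 0 at 0, so only the first step is shortened by
    [d]. *)
Lemma path_arith k d l x : d < k -> l * k - d < x <= l * k - d + k ->
  path (step k) 0 (rcons [seq i * k - d | i <- iota 1 l] x).
Proof.
move=> dk lx.
suff gen j : (j + l) * k - d < x <= (j + l) * k - d + k ->
    path (step k) (j * k - d) (rcons [seq i * k - d | i <- iota j.+1 l] x).
  exact: (gen 0).
elim: l j {lx} => [|l IHl] j /=; first by rewrite addn0 /step andbT.
rewrite addnS -addSn => /IHl ->; rewrite /step andbT.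
by case: j => [|j]; rewrite !mulSn; lia.
Qed.

Lemma path_arith_div k d x : d < k -> 0 < x ->
  path (step k) 0 (rcons [seq i * k - d | i <- iota 1 ((x + d).-1 %/ k)] x).
Proof.
move=> dk x0; have k0 : 0 < k by lia.
apply: path_arith => //.
by have := divn_eq (x + d).-1 k; have := ltn_pmod (x + d).-1 k0; lia.
Qed.

Lemma rainbow_criterion n (C : eqType) (c : 'I_n -> C) k :
    (forall u x, 0 < x < n -> exists2 s, path (step k) 0 (rcons s x)
                                 & uniq [seq c (shift u y) | y <- s]) ->
  rainbow_vertex_connected (circulant n (iota 1 k)) c.
Proof.
move=> cP u v; have [[|x] xn ->] := shiftP u v.
  by exists [::]; rewrite shift0 /dipath /= eqxx.
have [//|s sx us] := cP u x.+1; have [dp int] := dipath_shift u sx xn.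
by exists [seq shift u y | y <- rcons s x.+1]; rewrite /rainbow int -map_comp.
Qed.

Lemma strongly_rainbow_criterion n (C : eqType) (c : 'I_n -> C) k : 0 < k ->
    (forall u x, x.+1 < n -> exists s, [/\ path (step k) 0 (rcons s x.+1),
       size s = x %/ k & uniq [seq c (shift u y) | y <- s]]) ->
  strongly_rainbow_vertex_connected (circulant n (iota 1 k)) c.
Proof.
move=> k0 cP u v; have [[|x] xn ->] := shiftP u v.
  exists [::]; split=> //; rewrite shift0 /geodesic /dipath /= eqxx.
  by split=> // q; case: q.
have [s [sx ss us]] := cP u x xn; have [dp int] := dipath_shift u sx xn.
exists [seq shift u y | y <- rcons s x.+1].
rewrite /rainbow int -map_comp; split=> //; split=> // q /dipath_lift /(_ xn).
by rewrite size_map size_rcons ss ltn_divLR.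
Qed.

Lemma windows_walk n (C : eqType) (c : 'I_n -> C) k w u x : 0 < k ->
    windows c k w -> x %/ k <= w ->
  exists s, [/\ path (step k) 0 (rcons s x.+1),
    size s = x %/ k & uniq [seq c (shift u y) | y <- s]].
Proof.
move=> k0 cw xw; exists [seq i * k - 0 | i <- iota 1 (x %/ k)]; split.
- by have := @path_arith_div k 0 x.+1 k0; rewrite addn0; apply.
- by rewrite size_map size_iota.
rewrite -map_comp (eq_map (g := fun i => c (shift u (i * k)))).
  exact: windows_uniq cw xw.
by move=> i; rewrite /= subn0.
Qed.

Lemma windows_strongly n (C : eqType) (c : 'I_n -> C) k w : 0 < k ->
    windows c k w -> n <= (w.+1 * k).+1 ->
  strongly_rainbow_vertex_connected (circulant n (iota 1 k)) c.
Proof.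
move=> k0 cw nw; apply: strongly_rainbow_criterion => // u x xn.
have xw : x %/ k <= w by rewrite -ltnS ltn_divLR //; lia.
exact: windows_walk cw xw.
Qed.

(** Targets at distance more than [w + 1] share the internal vertices of the walk to [n - 1]:
    [last 0 s] is at most [(w + 1) * k], below all of them, and within [k] of [n - 1]. *)
Lemma windows_strongly_last n (C : eqType) (c : 'I_n -> C) k w : 0 < k ->
    windows c k w ->
    (forall u, exists s, [/\ path (step k) 0 (rcons s n.-1), size s = w.+1
                           & uniq [seq c (shift u y) | y <- s]]) ->
  strongly_rainbow_vertex_connected (circulant n (iota 1 k)) c.
Proof.
move=> k0 cw last_c; apply: strongly_rainbow_criterion => // u x xn.
have [xw|wx] := leqP (x %/ k) w.
  exact: windows_walk cw xw.
have [s [sn ss us]] := last_c u; exists s.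
move: (sn); rewrite -cats1 cat_path /= andbT => /andP[s0 sl].
have sw := last_step s0; rewrite leq_divRL // in wx.
rewrite /step ss in sl sw; split=> //; last first.
  rewrite ss; apply/eqP; rewrite eqn_leq leq_divRL // wx -ltnS ltn_divLR //=.
  lia.
by rewrite -cats1 cat_path s0 /= andbT /step; lia.
Qed.

Lemma rvc_diameter n m (c : 'I_n -> 'I_m) k : 0 < n ->
    rainbow_vertex_connected (circulant n (iota 1 k)) c ->
  n <= (m.+1 * k).+1.
Proof.
case: n c => // n c _ rc; have [p [dp r]] := rc ord0 (shift ord0 n).
rewrite ltnS (leq_trans (dipath_lift dp (ltnSn n))) // leq_mul2r.
by rewrite (rainbow_size r) orbT.
Qed.

(** With [m] colours a rainbow path has length at most [m + 1], so a target at [(m + 1) * k] forces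
    its internal vertices. *)
Lemma rvc_forced n m (c : 'I_n -> 'I_m) k : 0 < k <= n -> m.+1 * k < n ->
    rainbow_vertex_connected (circulant n (iota 1 k)) c ->
  windows c k m.
Proof.
case/andP=> k0 kn mn rc; apply: uniq_windows kn _ => u.
have [p [dp r]] := rc u (shift u (m.+1 * k)).
move: (r); rewrite /rainbow (dipath_forced dp mn (rainbow_size r) k0).
by rewrite -map_comp.
Qed.

Lemma srvc_forced n (C : eqType) (c : 'I_n -> C) k l :
    0 < k <= n -> l.+1 * k < n ->
    strongly_rainbow_vertex_connected (circulant n (iota 1 k)) c ->
  windows c k l.
Proof.
case/andP=> k0 kn ln rc; apply: uniq_windows kn _ => u.
have [p [[dp pmin] r]] := rc u (shift u (l.+1 * k)).
have /(dipath_shift u) /(_ ln) [/pmin] :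
    path (step k) 0 (rcons [seq i * k - 0 | i <- iota 1 l] (l.+1 * k)).
  by apply: path_arith => //; lia.
rewrite size_map size_rcons size_map size_iota => pl _.
by move: r; rewrite /rainbow (dipath_forced dp ln pl k0) -map_comp.
Qed.

(** * Colourings *)

Lemma block_colouring n k : 0 < k ->
  exists c : 'I_n -> 'I_(ceil_div n k),
    strongly_rainbow_vertex_connected (circulant n (iota 1 k)) c.
Proof.
move=> k0.
have lt_ceil (v : 'I_n) : v %/ k < ceil_div n k.
  rewrite ltnNge ceil_div_leq // -ltnNge.
  exact: leq_ltn_trans (leq_trunc_div v k) (ltn_ord v).
exists (fun v => Ordinal (lt_ceil v)).
apply: (@windows_strongly _ _ _ _ (n %/ k) k0); last first.
  by have := ltn_ceil n k0; lia.
move=> v j /andP[j0]; rewrite leq_divRL // mulSn => jn.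
have v_n := ltn_ord v; rewrite -val_eqE /=; apply/eqP.
have [vn|nv] := ltnP (v + j * k) n.
  by rewrite modn_small // addnC divnMDl //; lia.
(* Past the end, [v + j * k - n + k <= v] because [(j + 1) * k <= n], so the block index is strictly
   smaller. *)
rewrite -(subnK nv) modnDr modn_small; last by lia.
have : (v + j * k - n + k) %/ k <= v %/ k by apply: leq_div2r; lia.
by rewrite -[X in _ + X]mul1n addnC divnMDl //; lia.
Qed.

(** Since [n = (a - 1) * k + (k + 1)], the hypothesis makes [k] equal to -1 modulo [a - 1]; so for
    the colouring by residues modulo [a - 1], steps of [k] run cyclically through all colours. *)
Lemma modular_colouring k a : 3 <= a -> a - 1 %| a * k + 1 ->
  exists c : 'I_(a * k + 1) -> 'I_(a - 1),
    strongly_rainbow_vertex_connected (circulant (a * k + 1) (iota 1 k)) c.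
Proof.
move=> a3 dvd_n; case: k dvd_n => [|k]; first by rewrite muln0 dvdn1; lia.
move=> dvd_n.
have a0 : 0 < a - 1 by lia.
exists (fun v => Ordinal (ltn_pmod v a0)).
apply: (@windows_strongly _ _ _ _ (a - 1)) => //; last first.
  by rewrite subn1 prednK ?addn1 //; lia.
move=> v j ja; rewrite -val_eqE /= modn_dvdm //.
rewrite -{1}[val v]addn0 eqn_modDl mod0n.
rewrite eq_sym -/(dvdn _ _) Gauss_dvdl; first by rewrite gtnNdvd; lia.
have : a - 1 %| k.+1 + 1.
  rewrite -(dvdn_addr _ (dvdn_mulr k.+1 (dvdnn (a - 1)))).
  by apply: etrans dvd_n; congr dvdn; lia.
move=> /dvdnP[q e]; rewrite coprime_sym; apply/coprimeP => //.
by exists (k.+1, k * q); rewrite /= -mulnA -e; lia.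
Qed.

(* [f] is a coordinate along the orbits of the rotation by [k], each a cycle of
   length [L]; the translation by [g] preserves every orbit and acts as [+ q]. *)
Lemma orbit_coordinate n k : 0 < k < n ->
  let g := gcdn k n in let L := n %/ g in
  exists f q, [/\ k * q = g %[mod n], forall x, f (x %% n) = f x,
    forall x i, f (x + i * k) = (f x + i) %% L &
    forall x, f (x + g) = (f x + q) %% L].
Proof.
move=> /andP[k0 kn] g L; have [q km e _] := egcdnP n k0.
have g0 : 0 < g by rewrite gcdn_gt0 k0.
have nE : n = L * g by rewrite divnK // dvdn_gcdr.
have kE : k = k %/ g * g by rewrite divnK // dvdn_gcdl.
(* By Bezout, [q] is an inverse of [k %/ g] modulo [L], so multiplying [x %/ g] by it turns steps of
   [k] into steps of 1. *)
exists (fun x => (x %/ g * q) %% L), q; split=> [|x|x i|x].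
- by rewrite mulnC e modnMDl.
- by rewrite {1}nE -modn_divl modnMml.
- rewrite [in LHS]kE mulnA addnC divnMDl // mulnDl addnC modnDml.
  apply/eqP; rewrite eqn_modDl -mulnA; apply/eqP.
  have -> : k %/ g * q = km * L + 1.
    apply/eqP; rewrite -(eqn_pmul2r g0) mulnAC -kE mulnC e mulnDl mul1n -mulnA.
    by rewrite -nE.
  by rewrite mulnDr muln1 mulnA modnMDl.
- by rewrite divnDr // divnn g0 modnDml mulnDl mul1n.
Qed.

Lemma modn_window_inj a b i j : 0 < i <= a -> 0 < j <= a ->
  b + i = b + j %[mod a] -> i = j.
Proof.
wlog ij : i j / i <= j => [hw ia ja e|ia ja /esym/eqP].
  by case/orP: (leq_total i j) => ij; [exact: hw|exact/esym/hw].
rewrite eqn_modDl eqn_mod_dvd // => /dvdnP[[|t]]; first lia.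
by rewrite mulSn; lia.
Qed.

Lemma seam_colouring n k a r : n = a * k + r -> 0 < r < k -> 0 < a ->
  exists c : 'I_n -> 'I_a,
    rainbow_vertex_connected (circulant n (iota 1 k)) c.
Proof.
move=> nE /andP[r0 rk] a0.
have k0 : 0 < k by exact: leq_ltn_trans rk.
have kn : 0 < k < n by rewrite k0 nE -{1}[k]addn0 -addnS leq_add // leq_pmull.
have [f [q []]] := orbit_coordinate kn.
have gk := dvdn_gcdl k n; have gn := dvdn_gcdr k n.
have g0 : 0 < gcdn k n by rewrite gcdn_gt0 k0.
move: (gcdn k n) gk gn g0 => g gk gn g0; have nLg := divnK gn.
move: (n %/ g) nLg => L nLg kq f_mod fD fg.
have gr : g %| r by rewrite -(dvdn_addr _ (dvdn_mull a gk)) -nE.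
have g_r : g <= r by rewrite dvdn_leq.
have g_kr : g <= k - r by rewrite dvdn_leq ?subn_gt0 // dvdn_sub.
have g_k : g < k by exact: leq_ltn_trans rk.
have g_n : g < n by case/andP: kn => _; exact: ltn_trans.
have L0 : 0 < L by case: (L) nLg g_n => // <-.
pose c (v : 'I_n) := Ordinal (ltn_pmod (f v) a0); exists c.
apply: rainbow_criterion => u x x_n.
(* Colours are coordinates modulo [a], so a window of at most [a] vertices is rainbow when its
   coordinates do not wrap past [L]. *)
have good (v : 'I_n) l : f v + a < L -> l <= a ->
    uniq [seq c (shift v (i * k)) | i <- iota 1 l].
  move=> fva la; rewrite map_inj_in_uniq ?iota_uniq // => i j.
  rewrite !mem_iota => il jl /(congr1 val) /=.
  have fs b : 0 < b <= a -> f ((v + b * k) %% n) = f v + b.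
    case/andP=> _ ba; rewrite f_mod fD modn_small //.
    by rewrite (leq_ltn_trans _ fva) ?leq_add2l.
  have la' b : 0 < b < 1 + l -> 0 < b <= a.
    by case/andP=> -> bl; rewrite (leq_trans _ la).
  by rewrite !fs; [move/modn_window_inj; apply| |]; exact: la'.
have mod_k b : k * b = k * (b %% L) %[mod n].
  rewrite {1}(divn_eq b L) mulnDr -{1}(divnK gk).
  have -> : k %/ g * g * (b %/ L * L) = k %/ g * (b %/ L) * (L * g) by lia.
  by rewrite nLg modnMDl.
have f_lt y : f y < L.
  by have := fD y 0; rewrite mul0n !addn0 => ->; rewrite ltn_pmod.
have akn b : b < a -> b * k + k < n.
  rewrite -mulSnr nE => ba; rewrite -[b.+1 * k]addn0 -addnS leq_add //.
  by rewrite leq_mul2r ba orbT.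
have [fu|fu] := ltnP (f u + a) L.
  exists [seq i * k - 0 | i <- iota 1 (x.-1 %/ k)].
    by have := @path_arith_div k 0 x k0; rewrite addn0; apply; case/andP: x_n.
  rewrite -map_comp (eq_map (g := fun i => c (shift u (i * k)))).
    apply: good => //; rewrite -ltnS ltn_divLR // mulSn.
    by clear -x_n rk nE; lia.
  by move=> i; rewrite /= subn0.
have [w uw] : exists w, u = shift w g.
  exists (shift u (n - g)); rewrite shiftD subnK; last exact: ltnW.
  by rewrite (@shift_mod _ u n 0) ?modnn ?mod0n ?shift0.
(* If both windows wrapped, the coordinates of [u] and [w] would differ by some [b < a], so [g]
   would be [b * k] or [- b * k] modulo [n]; this is impossible as [0 < g < k] and
   [b * k + k < n]. *)
have fw : f w + a < L.
  rewrite ltnNge; apply/negP => fw.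
  have fwu : f w + q = f u %[mod L].
    by rewrite [in RHS]uw [X in _ = X %[mod _]](f_mod (w + g)) fg modn_mod.
  have [wu|/ltnW uw'] := leqP (f w) (f u).
    have ba : f u - f w < a by rewrite ltn_subLR // (leq_trans (f_lt u)).
    have : k * q = k * (f u - f w) %[mod n].
      rewrite mod_k [RHS]mod_k; congr (k * _ %% n).
      by apply/eqP; rewrite -(eqn_modDl (f w)) subnKC //; apply/eqP.
    have bn := leq_ltn_trans (leq_addr _ _) (akn _ ba).
    rewrite kq mulnC !modn_small // => gE.
    have := g_k; rewrite gE; case: (f u - f w) gE => [|b] gE.
      by move: g0; rewrite gE.
    by rewrite mulSn ltnNge leq_addr.
  have ba : f w - f u < a by rewrite ltn_subLR // (leq_trans (f_lt w)).
  have : k * (q + (f w - f u)) = k * 0 %[mod n].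
    rewrite mod_k [RHS]mod_k; congr (k * _ %% n).
    apply/eqP; rewrite -(eqn_modDl (f u)) addn0 addnCA subnKC // addnC.
    exact/eqP.
  rewrite mulnDr -modnDml kq modnDml mulnC muln0 mod0n modn_small.
    by move/eqP; rewrite mulnC addn_eq0 -leqn0 leqNgt g0.
  by apply: leq_ltn_trans (akn _ ba); rewrite addnC leq_add2l ltnW.
(* At most [a] internal vertices suffice: [g] divides [k - r], so
   [a * k - g + k >= a * k + r = n]. *)
exists [seq i * k - g | i <- iota 1 (minn a ((x + g).-1 %/ k))].
  have [la|al] := leqP ((x + g).-1 %/ k) a.
    apply: path_arith_div; last by case/andP: x_n.
    exact: g_k.
  apply: path_arith; first exact: g_k.
  rewrite leq_divRL // mulSn in al; clear -x_n al g_kr rk g0 nE; lia.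
rewrite -map_comp (@eq_in_map _ _ _ (fun i => c (shift w (i * k))) _).1.
  by apply: good => //; rewrite geq_minl.
move=> i; rewrite mem_iota => il /=; rewrite {1}uw shiftD subnKC //.
by case: i il => [//|i] _; rewrite (leq_trans (ltnW g_k)) ?leq_pmull.
Qed.

(** Places fewer than [p] apart lie in one interval or in cyclically consecutive ones. In the latter
    case the colour rises by [j < p] and drops by the length of the first interval, which is at
    least [p]. *)
Lemma two_interval_cycle p y z m j (G := fun m =>
      if m < y * p.+1 then m %% p.+1 else (m - y * p.+1) %% p) :
    0 < y -> 0 < z -> m < y * p.+1 + z * p -> 0 < j < p ->
  G m != G ((m + j) %% (y * p.+1 + z * p)).
Proof.
rewrite {}/G; case: y z => [//|y] [//|z] _ _; rewrite !mulSn.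
have modP i : (y * p.+1 + i) %% p.+1 = i %% p.+1 by rewrite modnMDl.
have modp i : (z * p + i) %% p = i %% p by rewrite modnMDl.
have neq_mod q b i : 0 < i < q -> b %% q != (b + i) %% q.
  by move=> iq; rewrite -{1}[b]addn0 eqn_modDl mod0n modn_small; lia.
move: (y * p.+1) (z * p) modP modp => s t modP modp m_n jp.
have [mjn|nmj] := ltnP (m + j) (p.+1 + s + (p + t)); last first.
  have -> : (m + j) %% (p.+1 + s + (p + t)) = m + j - (p.+1 + s + (p + t)).
    by rewrite -{1}(subnK nmj) modnDr modn_small; clear -m_n jp nmj; lia.
  rewrite ifF; last by clear -m_n jp nmj; lia.
  rewrite ifT; last by clear -m_n jp nmj; lia.
  have -> : m - (p.+1 + s) = t + (m - (p.+1 + s + t)).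
    by clear -m_n jp nmj; lia.
  by rewrite modp !modn_small; clear -m_n jp nmj; lia.
rewrite (modn_small mjn).
have [mjy|yj] := ltnP (m + j) (p.+1 + s).
  by rewrite ifT ?neq_mod //; clear -jp mjy; lia.
have [my|ym] := ltnP m (p.+1 + s); last first.
  have -> : m + j - (p.+1 + s) = m - (p.+1 + s) + j by clear -ym; lia.
  exact: neq_mod.
have -> : m = s + (m - s) by clear -yj jp; lia.
by rewrite modP !modn_small; clear -jp my yj; lia.
Qed.

(* The orbit, a cycle of length [a * k + 1], is cut into [k + 2 - a] intervals
   coloured 0, ..., a - 1 followed by [a - 1] intervals coloured 0, ..., a - 2. *)
Lemma two_interval_colouring n k a : n = a * k + 1 -> 2 <= k ->
    3 <= a < k + 2 ->
  exists c : 'I_n -> 'I_a,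
    strongly_rainbow_vertex_connected (circulant n (iota 1 k)) c.
Proof.
move=> nE k2 /andP[a3 ak].
have kn : 0 < k < n.
  by rewrite nE; case: (a) a3 => // b _; rewrite mulSn; clear -k2; lia.
have [f [q [_ f_mod fD _]]] := orbit_coordinate kn.
have gn : gcdn k n = 1 by rewrite nE gcdnMDl gcdn1.
rewrite gn divn1 in f_mod fD.
case: a a3 ak nE => [//|p] p2 pk nE.
pose y := k.+1 - p.
pose G m := if m < y * p.+1 then m %% p.+1 else (m - y * p.+1) %% p.
have G_lt m : G m < p.+1.
  rewrite /G; case: ifP => _; first by rewrite ltn_pmod.
  by rewrite ltnW // ltnS ltn_pmod; clear -p2; lia.
(* The intervals fill the orbit exactly, because [(1 - p) * (p + 1) + p * p = 1] over the
   integers. *)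
have {}nE : n = y * p.+1 + p * p.
  rewrite nE /y; have [e ->] : exists e, k = p + e.
    by exists (k - p); clear -pk; lia.
  by rewrite -addnS addKn; clear; lia.
exists (fun v => Ordinal (G_lt (f v))).
apply: (@windows_strongly _ _ _ _ p); first by clear -k2; lia.
  move=> v j ja; rewrite -val_eqE /= f_mod fD.
  have fvn : f v < n.
    have := fD v 0; rewrite mul0n !addn0 => ->.
    by rewrite ltn_pmod; clear -kn; lia.
  move: (f v) fvn => m; rewrite nE => mn.
  by apply: two_interval_cycle => //; rewrite /y; clear -p2 pk; lia.
rewrite nE /y; have [e ->] : exists e, k = p + e.
  by exists (k - p); clear -pk; lia.
by rewrite -addnS addKn; clear; lia.
Qed.

(** For [n = a * k], [v %/ k] is the place of [v] on its orbit, a cycle of length [a], and [v %% k]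
    names the orbit. The pair of equations serves as a rewriting multirule. *)
Lemma shift_block k a (v : 'I_(a * k)) i : 0 < k ->
  (shift v (i * k) %/ k = (v %/ k + i) %% a) * (shift v (i * k) %% k = v %% k).
Proof.
move=> k0; rewrite /= -modn_divl addnC divnMDl // addnC; split=> //.
by rewrite modn_dvdm ?dvdn_mull // modnMDl.
Qed.

(** A walk whose first step is [k - 1] and whose next steps are [k] runs on the orbit of the vertex
    before its start; this locates that vertex. *)
Lemma shift_pred_block k a (v : 'I_(a * k)) : 0 < k ->
  let w := shift v (a * k - 1) in
  if v %% k is r.+1 then ((w %/ k = v %/ k) * (w %% k = r))%type
  else ((w %/ k = (v %/ k + (a - 1)) %% a) * (w %% k = k - 1))%type.
Proof.
move=> k0; have n0 : 0 < a * k by apply: leq_ltn_trans (ltn_ord v).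
have a0 : 0 < a by move: n0; case: (a).
have vE := divn_eq v k; rewrite /=.
have va : v %/ k < a by rewrite ltn_divLR // ltn_ord.
rewrite -modn_divl modn_dvdm ?dvdn_mull //.
have -> : (v + (a * k - 1)) = (v %/ k + (a - 1)) * k + (v %% k + (k - 1)).
  rewrite {1}vE mulnDl mulnBl mul1n; have := leq_pmull k a0.
  by clear -k0; lia.
have := ltn_pmod v k0; case: (v %% k) => [|r] rk.
  have kk : k - 1 < k by rewrite ltn_subrL k0.
  by rewrite add0n divnMDl // modnMDl (divn_small kk) (modn_small kk) addn0.
have -> : r.+1 + (k - 1) = 1 * k + r by clear -k0; lia.
rewrite addnA -mulnDl divnMDl // modnMDl (divn_small (ltnW rk)).
rewrite (modn_small (ltnW rk)).
by rewrite addn0 -addnA subnK // modnDr modn_small.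
Qed.

Lemma strongly_rainbow_bounded (T : finType) (e : rel T) (c : T -> nat) m :
    (forall v, c v < m) -> strongly_rainbow_vertex_connected e c ->
  exists c' : T -> 'I_m, strongly_rainbow_vertex_connected e c'.
Proof.
move=> cm sc; exists (fun v => Ordinal (cm v)) => u v.
have [p [uv r]] := sc u v; exists p; split=> //.
by rewrite -(rainbow_inj _ _ _ val_inj).
Qed.

Lemma shift_before n (u : 'I_n) x :
  0 < x -> shift u (x - 1) = shift (shift u (n - 1)) x.
Proof.
move=> x0; have n0 := leq_ltn_trans (leq0n _) (ltn_ord u).
rewrite shiftD; apply: shift_mod; rewrite -[in RHS](subnKC x0) addnA subnK //.
by rewrite modnDl.
Qed.

(* The only bad window of an orbit is the one of its vertex of colour 1, and such
   vertices are never consecutive. *)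
Lemma three_block_colouring k : 2 <= k ->
  exists c : 'I_(3 * k) -> 'I_2,
    strongly_rainbow_vertex_connected (circulant (3 * k) (iota 1 k)) c.
Proof.
move=> k2; have k0 : 0 < k by lia.
(* Each orbit has a single vertex of colour 1, in block 0 or 1 according to the parity of the
   orbit. *)
pose c (v : 'I_(3 * k)) : nat := v %/ k == odd (v %% k).
apply: (@strongly_rainbow_bounded _ _ c) => [v|].
  by rewrite /c; case: eqP.
apply: (@windows_strongly_last _ _ _ _ 1 k0) => [v j|u]; first lia.
have cE v i : c (shift v (i * k)) = ((v %/ k + i) %% 3 == odd (v %% k)).
  by rewrite /c !(shift_block v i k0).
have walk d : d < 2 ->
    path (step k) 0 (rcons [seq i * k - d | i <- iota 1 2] (3 * k).-1).
  by move=> d2; apply: path_arith; clear -k2 d2; lia.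
have u3 : u %/ k < 3 by rewrite ltn_divLR // ltn_ord.
pose w := shift u (3 * k - 1).
have wE i : 0 < i -> shift u (i * k - 1) = shift w (i * k).
  by move=> i0; rewrite shift_before // muln_gt0 i0.
suff : c (shift u (1 * k)) != c (shift u (2 * k)) \/
       c (shift w (1 * k)) != c (shift w (2 * k)).
  case=> neq; [exists [seq i * k - 0 | i <- iota 1 2]|
               exists [seq i * k - 1 | i <- iota 1 2]];
    split=> //; try exact: walk.
    by rewrite /= !subn0 andbT inE.
  by rewrite [map _ _]/= !wE // /= andbT inE.
rewrite !cE; have := shift_pred_block u k0; rewrite /= -/w.
case: (u %% k) => [|r] pE; rewrite !pE.
  by move: (u %/ k) u3 => [|[|[|]]] //= _; [right; case: (odd _)|left|left].
by rewrite /=; move: (u %/ k) u3 => [|[|[|]]] //= _;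
  case: (odd r); by [left|right].
Qed.

(* [pat r] lists the colours of r, r + k, r + 2k, r + 3k.  In a pattern x y x z,
   the windows starting from one parity class of positions are good; this class
   alternates between neighbouring orbits.  For even k the alternation fails
   once around the cycle, where windows mixing the orbits of 0 and 1 are used. *)
Lemma four_block_colouring k : 2 <= k ->
  exists c : 'I_(4 * k) -> 'I_3,
    strongly_rainbow_vertex_connected (circulant (4 * k) (iota 1 k)) c.
Proof.
move=> k2; have k0 : 0 < k by lia.
pose pat r := if (r == 0) && ~~ odd k then [:: 1; 2; 1; 0]
  else if odd r (+) odd k then [:: 0; 1; 0; 2] else [:: 1; 0; 2; 0].
pose c (v : 'I_(4 * k)) := nth 0 (pat (v %% k)) (v %/ k).
have u4 (u : 'I_(4 * k)) : u %/ k < 4 by rewrite ltn_divLR // ltn_ord.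
have cE v i : c (shift v (i * k)) = nth 0 (pat (v %% k)) ((v %/ k + i) %% 4).
  by rewrite /c !(shift_block v i k0).
apply: (@strongly_rainbow_bounded _ _ c) => [v|].
  rewrite /c /pat; move: (v %/ k) (u4 v) => [|[|[|[|]]]] //= _;
  by do 2?case: ifP.
apply: (@windows_strongly_last _ _ _ _ 2 k0) => [v j j2|u].
  have -> : j = 1 by lia.
  rewrite cE /c /pat; move: (v %/ k) (u4 v) => [|[|[|[|]]]] //= _;
  by do 2?case: ifP.
pose w := shift u (4 * k - 1).
have wE i : 0 < i -> shift u (i * k - 1) = shift w (i * k).
  by move=> i0; rewrite shift_before // muln_gt0 i0.
(* A walk of four steps to [4 * k - 1] has exactly one step of [k - 1], the others being [k]; the
   four cases are its four possible positions. *)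
suff : [\/ uniq [seq c (shift u (i * k)) | i <- [:: 1; 2; 3]],
           uniq [seq c (shift w (i * k)) | i <- [:: 1; 2; 3]],
           uniq [:: c (shift u (1 * k)); c (shift u (2 * k));
                    c (shift w (3 * k))] |
           uniq [:: c (shift u (1 * k)); c (shift w (2 * k));
                    c (shift w (3 * k))]].
  case=> us; [exists [:: 1 * k; 2 * k; 3 * k]|
              exists [:: 1 * k - 1; 2 * k - 1; 3 * k - 1]|
              exists [:: 1 * k; 2 * k; 3 * k - 1]|
              exists [:: 1 * k; 2 * k - 1; 3 * k - 1]]; split=> //;
    by rewrite ?[map _ _]/= ?wE //= /step; clear -k2; lia.
rewrite /map !cE; have := shift_pred_block u k0; rewrite /= -/w.
have := ltn_pmod u k0.
case: (u %% k) => [|r] rk pE; rewrite !pE.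
  rewrite /pat oddB //=; have -> : (k - 1 == 0) = false by lia.
  move: (u %/ k) (u4 u) => [|[|[|[|]]]] //= _;
  case: (odd k); by [constructor 1|constructor 2].
rewrite /pat /=.
case: r {rk pE} => [|r] /=; rewrite ?negbK;
move: (u %/ k) (u4 u) => [|[|[|[|]]]] //= _;
case: (odd k) => //=; try (case: (odd r));
by [constructor 1|constructor 2|constructor 3|constructor 4].
Qed.

(** * Values of the parameters *)

Lemma ceil_divE a k r : 0 < r <= k -> ceil_div (a * k + r) k = a.+1.
Proof.
move=> /andP[r0 rk]; have k0 := leq_trans r0 rk; apply/eqP.
rewrite eqn_leq ceil_div_leq // mulSnr leq_add2l rk /=.
by rewrite ltnNge ceil_div_leq // -ltnNge -[X in X < _]addn0 ltn_add2l.
Qed.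

(** Windows of length [a - 1] are rainbow as [a * k < n], so a colour class has at most
    [n %/ (a - 1)] vertices. This is at most [k] because [n = (a - 1) * k + (k + r)], so [a] colours
    cover at most [a * k < n] vertices. *)
Lemma srvc_counting n k a r (c : 'I_n -> 'I_a) :
    n = a * k + r -> 0 < k -> 0 < r -> k + r < a - 1 ->
  ~ strongly_rainbow_vertex_connected (circulant n (iota 1 k)) c.
Proof.
move=> nE k0 r0; case: a => [|[|a]] // in c nE *; rewrite subn1 /= => kra src.
have ka : k <= a.+2 * k by rewrite leq_pmull.
have kn : 0 < k <= n by rewrite k0 nE (leq_trans ka) ?leq_addr.
have lt_n : a.+2 * k < n by rewrite nE -[X in X < _]addn0 ltn_add2l.
have a0 : 0 < a.+1 by [].
have := windows_bound a0 (srvc_forced kn lt_n src).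
rewrite leqNgt (leq_ltn_trans _ lt_n) // leq_mul2l -ltnS ltn_divLR // nE.
by rewrite mulSn addnAC [k.+1 * _]mulSn mulnC addnC; clear -kra; lia.
Qed.

(** If going from [i] to [j] takes at least [a - 2] steps, then closing the cycle from [j] back to
    [i] takes at most 2, and [2 < a - 2] as [a >= 5]. *)
Lemma windows_coset n k a (C : eqType) (c : 'I_n -> C) v :
    n = a * k -> 5 <= a -> windows c k (a - 2) ->
  injective (fun i : 'I_a => c (shift v (i * k))).
Proof.
move=> nE a5 cw i j; wlog lt_ij : i j / i < j => [hw|] e.
  have [/hw|/hw|/val_inj//] := ltngtP i j; first exact.
  by move=> h; exact/esym/h.
have [ji|ij] := ltnP (j - i) (a - 2).
  have ij0 : 0 < j - i < a - 2 by rewrite subn_gt0 lt_ij.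
  have := cw (shift v (i * k)) _ ij0.
  by rewrite shiftD -mulnDl subnKC ?e ?eqxx // ltnW.
have ja := ltn_ord j.
have aij : 0 < a - (j - i) < a - 2 by clear -lt_ij ij a5 ja; lia.
have back : shift v ((j + (a - (j - i))) * k) = shift v (i * k).
  have -> : j + (a - (j - i)) = a + i by clear -lt_ij ja; lia.
  by apply: shift_mod; rewrite mulnDl -nE modnDl.
by have := cw (shift v (j * k)) _ aij; rewrite shiftD -mulnDl back e eqxx.
Qed.

Lemma block_colouring_eq n k m : 0 < k -> ceil_div n k = m ->
  exists c : 'I_n -> 'I_m,
    strongly_rainbow_vertex_connected (circulant n (iota 1 k)) c.
Proof. by move=> k0 <-; exact: block_colouring. Qed.

Lemma srvc_long n k a r : n = a * k + r -> 0 < r < k -> k + r < a - 1 ->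
  is_srvc (circulant n (iota 1 k)) a.+1.
Proof.
move=> nE /andP[r0 rk] kra; apply: is_srvc_min => [|c].
  apply: block_colouring_eq; first by lia.
  by rewrite nE ceil_divE // r0 ltnW.
by apply: srvc_counting nE _ r0 kra; lia.
Qed.

Lemma rvc_residue n k a r : n = a * k + r -> 1 < r < k -> 0 < a ->
  is_rvc (circulant n (iota 1 k)) a.
Proof.
move=> nE /andP[r1 rk] a0; apply: is_rvc_min => [|c].
  by apply: seam_colouring nE _ a0; rewrite rk ltnW.
have n0 : 0 < n by rewrite nE (leq_trans (ltnW r1)) ?leq_addl.
move/rvc_diameter => /(_ n0); rewrite prednK // nE -[(a * k).+1]addn1.
by rewrite leq_add2l leqNgt r1.
Qed.

Lemma rvc_srvc_modular k a : 3 <= a -> 0 < k -> a - 1 %| a * k + 1 ->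
  is_rvc (circulant (a * k + 1) (iota 1 k)) (a - 1) /\
  is_srvc (circulant (a * k + 1) (iota 1 k)) (a - 1).
Proof.
move=> a3 k0 dvd_n; have [c src] := modular_colouring a3 dvd_n.
have low m (c' : 'I_(a * k + 1) -> 'I_m) : m < a - 1 ->
    ~ rainbow_vertex_connected (circulant (a * k + 1) (iota 1 k)) c'.
  move=> ma /rvc_diameter; rewrite addn1 => /(_ isT); rewrite ltnS leq_mul2r.
  by rewrite eqn0Ngt k0 /=; lia.
split; [apply: is_rvc_min => [|c' rc']|
        apply: is_srvc_min => [|c' /strongly_rainbow rc']].
- by exists c; exact: strongly_rainbow.
- by apply: low rc'; lia.
- by exists c.
- by apply: low rc'; lia.
Qed.

(** Rainbow windows of length [a - 1] give [n <= (a - 1) * (n %/ (a - 1))], which forces [a - 1] to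
    divide [n]. *)
Lemma no_rainbow_not_dvd n k a (c : 'I_n -> 'I_(a - 1)) :
    n = a * k + 1 -> 3 <= a -> 0 < k -> ~~ (a - 1 %| n) ->
  ~ rainbow_vertex_connected (circulant n (iota 1 k)) c.
Proof.
move=> nE a3 k0 ndvd rc; case/negP: ndvd.
have a0 : 0 < a - 1 by lia.
have mn : (a - 1).+1 * k < n by rewrite subn1 prednK ?nE ?addn1 // ltnW // ltnW.
have kn : 0 < k <= n by rewrite k0 (leq_trans _ (ltnW mn)) // leq_pmull.
have := windows_bound a0 (rvc_forced kn mn rc).
rewrite mulnC => h; apply/dvdnP; exists (n %/ (a - 1)).
by apply/eqP; rewrite eqn_leq h leq_trunc_div.
Qed.

Lemma no_rainbow_short k a m (c : 'I_(a * k) -> 'I_m) : 2 <= k -> m < a - 1 ->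
  ~ rainbow_vertex_connected (circulant (a * k) (iota 1 k)) c.
Proof.
move=> k2 ma /rvc_diameter; have n0 : 0 < a * k by rewrite muln_gt0; lia.
move/(_ n0); apply/negP; rewrite -ltnNge.
have : m.+2 * k <= a * k by rewrite leq_mul2r; lia.
by apply: leq_trans; rewrite (mulSn m.+1) -add2n leq_add2r.
Qed.

Unset Implicit Arguments.

Theorem theorem12 (k : nat) (hk : 2 <= k) :
  exists N : nat, forall n : nat, k <= n %/ 2 - 1 ->
    let D := circulant n (iota 1 k) in
    (* (a) *)
    (~~ (n == 0 %[mod k]) -> ~~ (n == 1 %[mod k]) ->
      is_rvc D (ceil_div n k - 1) /\
      (N <= n -> is_srvc D (ceil_div n k))) /\
    (* (b) *)
    (forall a : nat, n = a * k + 1 -> 3 <= a ->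
      (a - 1 %| n ->
        is_rvc D ((n - 1) %/ k - 1) /\ is_srvc D ((n - 1) %/ k - 1)) /\
      (~~ (a - 1 %| n) ->
        is_rvc D ((n - 1) %/ k) /\
        (a < k + 2 -> is_srvc D ((n - 1) %/ k)) /\
        (k + 2 < a ->
          is_srvc D ((n - 1) %/ k + 1) /\
          (n - 1) %/ k + 1 = ceil_div n k))) /\
    (* (c) *)
    (forall a : nat, n = a * k -> 3 <= a ->
      (a = 3 \/ a = 4 ->
        is_rvc D (n %/ k - 1) /\ is_srvc D (n %/ k - 1)) /\
      (5 <= a ->
        (is_rvc D (n %/ k - 1) \/ is_rvc D (n %/ k)) /\
        is_srvc D (n %/ k))).
Proof.
have k0 : 0 < k by lia.
(* This bound gives [n %/ k >= 2 * k + 2], hence [k + r < n %/ k - 1] for every remainder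
   [r < k]. *)
exists ((2 * k + 2) * k) => n k_n D; split; [|split].
- rewrite mod0n (modn_small hk) => n0 n1.
  have nE := divn_eq n k; have rk := ltn_pmod n k0.
  have r2 : 1 < n %% k by lia.
  have a0 : 0 < n %/ k by rewrite divn_gt0 //; lia.
  have cE : ceil_div n k = (n %/ k).+1.
    by rewrite {1}nE ceil_divE // (ltnW rk) ltnW.
  rewrite cE subn1 /=; split; first by apply: rvc_residue nE _ a0; rewrite r2.
  rewrite -leq_divRL // => Na; apply: srvc_long nE _ _.
    by rewrite rk ltnW.
  by clear -Na rk r2; lia.
- move=> a nE a3; have -> : (n - 1) %/ k = a by rewrite nE addnK mulnK.
  split=> dvd_n; first by rewrite /D nE in dvd_n *; exact: rvc_srvc_modular.
  have low := no_rainbow_not_dvd nE a3 k0 dvd_n.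
  rewrite subn1 in low; split; [|split].
  + apply: is_rvc_min => [|c]; last exact: low.
    by apply: seam_colouring nE _ _; lia.
  + move=> ak; apply: is_srvc_min => [|c /strongly_rainbow]; last exact: low.
    by apply: two_interval_colouring nE hk _; rewrite a3.
  + move=> ka; rewrite addn1; split; last by rewrite nE ceil_divE.
    by apply: srvc_long nE _ _; lia.
- move=> a nE a3; have -> : n %/ k = a by rewrite nE mulnK.
  rewrite /D {D} nE {n nE k_n}.
  split=> [a34|a5].
    have [c sc] : exists c : 'I_(a * k) -> 'I_(a - 1),
        strongly_rainbow_vertex_connected (circulant (a * k) (iota 1 k)) c.
      case: a34 => ->; first exact: three_block_colouring.
      exact: four_block_colouring.
    split; [apply: is_rvc_min => [|c']|
            apply: is_srvc_min => [|c' /strongly_rainbow]].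
    + by exists c; exact: strongly_rainbow.
    + by apply: no_rainbow_short => //; lia.
    + by exists c.
    + by apply: no_rainbow_short => //; lia.
  have ub : exists c : 'I_(a * k) -> 'I_a,
      strongly_rainbow_vertex_connected (circulant (a * k) (iota 1 k)) c.
    apply: block_colouring_eq => //; rewrite -(prednK (ltnW (ltnW a3))) mulSnr.
    by rewrite ceil_divE ?k0 /=.
  split; last first.
    apply: is_srvc_min => // c sc.
    have kn : 0 < k <= a * k by rewrite k0 leq_pmull; lia.
    have ln : (a - 2).+1 * k < a * k by rewrite ltn_mul2r k0; lia.
    have v : 'I_(a * k) by apply: (@Ordinal _ 0); rewrite muln_gt0 k0; lia.
    have cw := srvc_forced kn ln sc.
    (* The [a] vertices of one orbit would inject into [a - 1] colours. *)
    have := leq_card _ (windows_coset (v := v) (erefl _) a5 cw).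
    by rewrite !card_ord; lia.
  (* Excluded middle on whether [a - 1] colours suffice selects one of the two values. *)
  have [ex|no] := classic (exists c : 'I_(a * k) -> 'I_(a - 1),
     rainbow_vertex_connected (circulant (a * k) (iota 1 k)) c).
    by left; apply: is_rvc_min => // c; apply: no_rainbow_short => //; lia.
  right; apply: is_rvc_min => [|c rc].
    by have [c /strongly_rainbow] := ub; exists c.
  by apply: no; rewrite subn1; exists c.
Qed.
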